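(* Let $n>2$ be even, let $X\subset\mathbb{CP}^{n+1}$ be the quadric hypersurface $\sum_{j=0}^nz_j^2-z_{n+1}^2=0$, and let $L\cong S^n$ be its real locus. The open Gromov–Witten invariants of $(X,L)$ are entirely determined by the axioms of $\mathrm{OGW}$, the closed Gromov–Witten invariants of $X$, and the open-closed relation. Moreover, the closed Gromov–Witten invariants of $X$ are entirely determined by the axioms of $\mathrm{GW}$ (degree, unit, zero, divisor), the WDVV equations, and the value $\mathrm{GW}_1(\Delta_{n-1},\Delta_n)=4$. That is: (i) any family of multilinear maps $\widehat H^*(X,L;\mathbb{R})^{\otimes l}\to\mathbb{R}$ indexed by $(\beta,k,l)$ that vanishes for $k=0$, satisfies the open Gromov–Witten axioms and satisfies the open-closed relation with the closed invariants of $X$ (all listed in the context), coincides with $\mathrm{OGW}$; (ii) any family of symmetric multilinear maps $H^*(X;\mathbb{R})^{\otimes l}\to\mathbb{R}$ indexed by $(\beta,l)$, vanishing for $\beta<0$, that satisfies the $\mathrm{GW}$ axioms and the WDVV equations listed in the context and takes the value $4$ on $(\Delta_{n-1},\Delta_n)$ for $\beta=1$, coincides with $\mathrm{GW}$.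
   Context: Topology. $X$ carries the restricted Fubini–Study form $\omega$, $h=[\omega]$, $\Delta_j=h^j$ ($0\le j\le n$), $\int_Xh^n=2$, and $\Delta_L\in H^n(X;\mathbb{R})$ is the Poincaré dual of $[L]$, $\int_X\Delta_L^2=(-1)^{n/2}2$, $h\Delta_L=0$; $\{\Delta_0,\dots,\Delta_n,\Delta_L\}$ is a basis of $H^*(X;\mathbb{R})$, all of even degree. The natural map $\varpi:H_2(X;\mathbb{Z})\to H_2(X,L;\mathbb{Z})$ is an isomorphism, both groups identified with $\mathbb{Z}$ (a line being $1$), $\int_\beta h=\beta$, $c_1(\beta)=n\beta$, Maslov index $\mu(\beta)=2n\beta$. $L$ carries its unique relative spin structure with $w_{\mathfrak s}=0$. $\widehat H^*(X,L;\mathbb{R})$ is the cohomology of $\{\eta\in A^*(X):\int_L\eta=0\}$; since $[L]\neq0$, $\rho:\widehat H^*(X,L;\mathbb{R})\to H^*(X;\mathbb{R})$ is injective with image the kernel of integration over $L$ (spanned by $\Delta_0,\dots,\Delta_n$). Closed invariants $\mathrm{GW}_\beta:H^*(X;\mathbb{R})^{\otimes l}\to\mathbb{R}$ (genus zero). Axioms: (Degree) $\mathrm{GW}_\beta(A_1,\dots,A_l)=0$ unless $2n-6+2c_1(\beta)+2l=\sum|A_j|$. (Unit) $\mathrm{GW}_\beta(1,A_1,\dots,A_{l-1})=\int_XA_1\wedge A_2$ if $(\beta,l)=(0,3)$, and $0$ otherwise. (Zero) $\mathrm{GW}_0(A_1,\dots,A_l)=\int_XA_1\wedge A_2\wedge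 A_3$ if $l=3$, and $0$ otherwise. (Divisor) if $|A_l|=2$, $\mathrm{GW}_\beta(A_1,\dots,A_l)=\int_\beta A_l\cdot\mathrm{GW}_\beta(A_1,\dots,A_{l-1})$. WDVV: with $\Phi=\sum\frac{T^\beta\prod t_i^{r_i}}{\prod r_i!}\mathrm{GW}_\beta(\otimes\Delta_i^{\otimes r_i})$ and $(g^{ml})$ the inverse of the matrix $(\int_X\Delta_m\wedge\Delta_l)$, for all basis indices $u,v,w,y$: $\sum_{m,l}\partial_u\partial_v\partial_m\Phi\,g^{ml}\,\partial_l\partial_w\partial_y\Phi=\sum_{m,l}\partial_v\partial_w\partial_m\Phi\,g^{ml}\,\partial_l\partial_u\partial_y\Phi$. Open invariants $\mathrm{OGW}_{\beta,k}:\widehat H^*(X,L;\mathbb{R})^{\otimes l}\to\mathbb{R}$ (Solomon–Tukachinsky): the coefficients of $T^\beta s^k\prod t_i^{r_i}/(k!\prod r_i!)$ in the superpotential $(-1)^n\big(\sum_k\frac1{k+1}\langle\mathfrak m^\gamma_k(b^{\otimes k}),b\rangle+\mathfrak m^\gamma_{-1}\big)$ of the Fukaya $A_\infty$ algebra of $L$ (defined by $J$-holomorphic disks with boundary on $L$, bulk-deformed by $\gamma=\sum t_i\Gamma_i$, $\Gamma_i$ a basis of $\widehat H^*(X,L;\mathbb{R})$) at a bounding chain $b$ with $\int_Lb=s$, where by definition $\mathrm{OGW}_{\beta,0}=0$ for $\beta\in\mathrm{Im}\,\varpi$ (here: for all $\beta$). Axioms: (Degree) $\mathrm{OGW}_{\beta,k}(A_1,\dots,A_l)=0$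 unless $n-3+\mu(\beta)+k+2l=kn+\sum|A_j|$; (Unit) $\mathrm{OGW}_{\beta,k}(1,A_1,\dots,A_{l-1})=-1$ if $(\beta,k,l)=(0,1,1)$ and $0$ otherwise; (Zero) $\mathrm{OGW}_{0,k}(A_1,\dots,A_l)=-1$ if $(k,l)=(1,1)$, $A_1=1$, and $0$ otherwise; (Divisor) if $|A_l|=2$, $\mathrm{OGW}_{\beta,k}(A_1,\dots,A_l)=\int_\beta A_l\cdot\mathrm{OGW}_{\beta,k}(A_1,\dots,A_{l-1})$. Open-closed relation: $\mathrm{OGW}_{\beta,k}(\eta_1,\dots,\eta_l)=0$ if $k\ge2$ (or if $k\ge1$ and $\beta\notin\mathrm{Im}\,\varpi$), and for $\eta\in H^n(X;\mathbb{R})$ with $\int_L\eta=1$, $\mathrm{OGW}_{\beta,1}(\eta_1,\dots,\eta_l)=(-1)^{n+1}\mathrm{GW}_{\beta}(\eta,\Delta_L,\rho(\eta_1),\dots,\rho(\eta_l))$. $\mathrm{OGW}$ and $\mathrm{GW}$ are known to satisfy all of these.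
   Formalization: The closed divisor axiom is required only for (β,l)≠(0,3), since otherwise it contradicts the zero axiom (GW_0(1,Δ_{n-1},Δ_1)=2, not 0), and the open zero axiom's ''0 otherwise'' at (k,l)=(1,1) is read for A_1 of positive degree, as linearity in A_1 requires. *)

(* Defs.v *)
From HB Require Import structures.
From mathcomp Require Import all_boot all_order all_algebra.
From mathcomp Require Import reals.
From mathcomp Require Import mpoly.

Set Implicit Arguments.
Unset Strict Implicit.
Unset Printing Implicit Defensive.

Import GRing.Theory Num.Theory.
Local Open Scope ring_scope.

(* Index j <= n stands for Delta_j = h^j, index n+1 for Delta_L. *)
Definition delta (R : realType) (n : nat) (H : comAlgType R) (h dL : H)
    (i : 'I_n.+2) : H :=
  if (i <= n)%N then h ^+ i else dL.

Definition delta_deg (n : nat) (i : 'I_n.+2) : nat :=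
  if (i <= n)%N then (2 * i)%N else n.

Definition homogeneous (R : realType) (n : nat) (H : comAlgType R) (h dL : H)
    (d : nat) (A : H) : Prop :=
  exists c : 'I_n.+2 -> R,
    A = \sum_(i < n.+2 | delta_deg i == d) c i *: delta h dL i.

(* Cohomological data of the pair (X, L): the real cohomology algebra of the
   n-dimensional quadric X (commutative, all degrees being even), integration
   over X, over the sphere L and over a line, and the relative cohomology
   \hat H^*(X, L; R) with its natural map rho to H^*(X; R). *)
Record quadric (R : realType) (n : nat) := Quadric {
  coh : comAlgType R;
  hyp : coh;    (* h, the class of the restricted Fubini-Study form *)
  dualL : coh;  (* Delta_L, the Poincare dual of [L] *)
  intX : {linear coh -> R^o};
  intL : {linear coh -> R^o};
  int_line : {linear coh -> R^o};
  delta_basis : forall A : coh, exists! c : {ffun 'I_n.+2 -> R},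
    A = \sum_(i < n.+2) c i *: delta hyp dualL i;
  coh_graded : forall (d e : nat) (A B : coh),
    homogeneous n hyp dualL d A -> homogeneous n hyp dualL e B ->
    homogeneous n hyp dualL (d + e) (A * B);
  intX_deg : forall (d : nat) (A : coh),
    homogeneous n hyp dualL d A -> d != (2 * n)%N -> intX A = 0;
  intX_hyp : intX (hyp ^+ n) = 2;
  intX_dualL : intX (dualL * dualL) = (-1) ^+ n./2 * 2;
  hyp_dualL : hyp * dualL = 0;
  intL_dual : forall A : coh, intL A = intX (A * dualL);
  int_line_deg : forall (d : nat) (A : coh),
    homogeneous n hyp dualL d A -> d != 2%N -> int_line A = 0;
  int_line_hyp : int_line hyp = 1;
  rel_coh : lmodType R;
  rho : {linear rel_coh -> coh};
  rho_inj : injective rho;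
  rho_image : forall A : coh, (exists eta : rel_coh, rho eta = A) <-> intL A = 0
}.

Section QuadricNotions.
Variables (R : realType) (n : nat) (Q : quadric R n).

Definition Delta (i : 'I_n.+2) : coh Q := delta (hyp Q) (dualL Q) i.

Definition of_deg (d : nat) (A : coh Q) : Prop :=
  homogeneous n (hyp Q) (dualL Q) d A.

(* rho is injective and preserves degrees, so it detects them. *)
Definition rel_of_deg (d : nat) (eta : rel_coh Q) : Prop := of_deg d (rho Q eta).

(* H_2(X; Z) and H_2(X, L; Z) are both identified with Z, a line being 1. *)
Definition varpi (beta : int) : int := beta.

Definition chern1 (beta : int) : int := n%:Z * beta.

Definition maslov (beta : int) : int := (2 * n)%:Z * beta.

Definition pairing (beta : int) (A : coh Q) : R := beta%:~R * int_line Q A.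

(* The pairing of the relative class beta with eta of degree 2; through varpi
   it is the pairing of the absolute class with rho eta. *)
Definition rel_pairing (beta : int) (eta : rel_coh Q) : R :=
  pairing beta (rho Q eta).

End QuadricNotions.

(* The d_j are the degrees of the homogeneous classes A_j. *)
Definition degrees (V : zmodType) (hom : nat -> V -> Prop)
    (d : seq nat) (A : seq V) : Prop :=
  size d = size A /\
  forall j : nat, (j < size A)%N -> hom (nth 0%N d j) (nth 0 A j).

(* A family, indexed by l, of maps V^l -> R is a single map on sequences. *)
Definition multilinear_family (R : realType) (V : lmodType R)
    (f : seq V -> R) : Prop :=
  forall (s t : seq V) (a : R) (u v : V),
    f (s ++ (a *: u + v) :: t) = a * f (s ++ u :: t) + f (s ++ v :: t).

Definition symmetric_family (R : realType) (V : lmodType R)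
    (f : seq V -> R) : Prop :=
  forall s t : seq V, perm_eq s t -> f s = f t.

(* Formal power series in T and t_0, ..., t_(N-1): F b r is the coefficient
   of T^b \prod_i t_i^(r i). *)
Definition fps (R : realType) (N : nat) := nat -> 'X_{1..N} -> R.

Definition fps_deriv (R : realType) (N : nat) (i : 'I_N) (F : fps R N) :
    fps R N :=
  fun b r => F b (r + U_(i))%MM *+ (r i).+1.

Definition fps_mul (R : realType) (N : nat) (F G : fps R N) : fps R N :=
  fun b r =>
    \sum_(c < b.+1)
      \sum_(k : 'X_{1..N < (mdeg r).+1, (mdeg r).+1} | r == (k.1 + k.2)%MM)
        F c k.1 * G (b - c)%N k.2.

Section ClosedInvariants.
Variables (R : realType) (n : nat) (Q : quadric R n).

Definition closed_family := int -> seq (coh Q) -> R.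

Implicit Type GW : closed_family.

Definition insertions (r : 'X_{1..n.+2}) : seq (coh Q) :=
  flatten [seq nseq (r i) (Delta Q i) | i <- enum 'I_n.+2].

(* Only families vanishing for beta < 0 are considered, so that only
   nonnegative powers of T occur. *)
Definition potential GW : fps R n.+2 :=
  fun b r => GW b%:Z (insertions r) / (\prod_(i < n.+2) (r i)`!)%:R.

Definition poincare_matrix : 'M[R]_n.+2 :=
  \matrix_(m, l) intX Q (Delta Q m * Delta Q l).

Definition wdvv_side GW (u v w y : 'I_n.+2) : fps R n.+2 :=
  fun b r =>
    \sum_(m < n.+2) \sum_(l < n.+2)
      invmx poincare_matrix m l *
      fps_mul (fps_deriv u (fps_deriv v (fps_deriv m (potential GW))))
              (fps_deriv l (fps_deriv w (fps_deriv y (potential GW)))) b r.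

Definition WDVV GW : Prop :=
  forall (u v w y : 'I_n.+2) (b : nat) (r : 'X_{1..n.+2}),
    wdvv_side GW u v w y b r = wdvv_side GW v w u y b r.

(* The divisor axiom necessarily excludes (beta, l) = (0, 3): there the zero
   axiom gives GW_0(1, h^(n-1), h) = 2, whereas the pairing of 0 with h is 0. *)
Record closed_axioms GW : Prop := ClosedAxioms {
  closed_degree : forall (beta : int) (A : seq (coh Q)) (d : seq nat),
    degrees (@of_deg R n Q) d A ->
    (2 * n)%:Z - 6 + 2 * chern1 n beta + (2 * size A)%:Z != (sumn d)%:Z ->
    GW beta A = 0;
  closed_unit03 : forall A1 A2 : coh Q,
    GW 0 [:: 1; A1; A2] = intX Q (A1 * A2);
  closed_unit : forall (beta : int) (A : seq (coh Q)),
    ~~ ((beta == 0) && ((size A).+1 == 3%N)) -> GW beta (1 :: A) = 0;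
  closed_zero3 : forall A1 A2 A3 : coh Q,
    GW 0 [:: A1; A2; A3] = intX Q (A1 * A2 * A3);
  closed_zero : forall A : seq (coh Q), size A != 3%N -> GW 0 A = 0;
  closed_divisor : forall (beta : int) (A : seq (coh Q)) (B : coh Q),
    of_deg 2 B -> ~~ ((beta == 0) && ((size A).+1 == 3%N)) ->
    GW beta (rcons A B) = pairing beta B * GW beta A
}.

Record closed_GW_theory GW : Prop := ClosedGWTheory {
  closed_multilinear : forall beta : int, multilinear_family (GW beta);
  closed_symmetric : forall beta : int, symmetric_family (GW beta);
  closed_negative : forall (beta : int) (A : seq (coh Q)),
    beta < 0 -> GW beta A = 0;
  closed_GW_axioms : closed_axioms GW;
  closed_WDVV : WDVV GW;
  closed_initial : GW 1 [:: Delta Q (inord n.-1); Delta Q (inord n)] = 4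
}.

End ClosedInvariants.

Section OpenInvariants.
Variables (R : realType) (n : nat) (Q : quadric R n).

Definition open_family := int -> nat -> seq (rel_coh Q) -> R.

Implicit Type OGW : open_family.

(* e with rho e = 1 is the unit class 1 of the relative cohomology. In the
   zero axiom with (k, l) = (1, 1), "0 otherwise" refers to homogeneous classes
   of positive degree, as multilinearity in A_1 requires. *)
Record open_axioms OGW : Prop := OpenAxioms {
  open_degree : forall (beta : int) (k : nat) (A : seq (rel_coh Q))
      (d : seq nat),
    degrees (@rel_of_deg R n Q) d A ->
    n%:Z - 3 + maslov n beta + k%:Z + (2 * size A)%:Z
      != (k * n)%:Z + (sumn d)%:Z ->
    OGW beta k A = 0;
  open_unit011 : forall e : rel_coh Q, rho Q e = 1 -> OGW 0 1%N [:: e] = -1;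
  open_unit : forall (e : rel_coh Q) (beta : int) (k : nat)
      (A : seq (rel_coh Q)),
    rho Q e = 1 -> ~~ [&& beta == 0, k == 1%N & (size A).+1 == 1%N] ->
    OGW beta k (e :: A) = 0;
  open_zero11 : forall e : rel_coh Q, rho Q e = 1 -> OGW 0 1%N [:: e] = -1;
  open_zero11_pos : forall (d : nat) (A1 : rel_coh Q),
    rel_of_deg d A1 -> (0 < d)%N -> OGW 0 1%N [:: A1] = 0;
  open_zero : forall (k : nat) (A : seq (rel_coh Q)),
    ~~ ((k == 1%N) && (size A == 1%N)) -> OGW 0 k A = 0;
  open_divisor : forall (beta : int) (k : nat) (A : seq (rel_coh Q))
      (B : rel_coh Q),
    rel_of_deg 2 B ->
    OGW beta k (rcons A B) = rel_pairing beta B * OGW beta k A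
}.

Record open_closed_relation (GW : closed_family Q) OGW : Prop :=
    OpenClosedRelation {
  open_closed_vanishing : forall (beta : int) (k : nat) (A : seq (rel_coh Q)),
    (2 <= k)%N \/ ((1 <= k)%N /\ ~ exists beta' : int, varpi beta' = beta) ->
    OGW beta k A = 0;
  open_closed : forall (beta : int) (eta : coh Q) (A : seq (rel_coh Q)),
    of_deg n eta -> intL Q eta = 1 ->
    OGW (varpi beta) 1%N A
      = (-1) ^+ n.+1 * GW beta (eta :: dualL Q :: [seq rho Q a | a <- A])
}.

Record open_GW_theory (GW : closed_family Q) OGW : Prop := OpenGWTheory {
  open_multilinear : forall (beta : int) (k : nat),
    multilinear_family (OGW beta k);
  open_no_boundary : forall (beta : int) (A : seq (rel_coh Q)),
    OGW beta 0 A = 0;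
  open_GW_axioms : open_axioms OGW;
  open_GW_closed : open_closed_relation GW OGW
}.

End OpenInvariants.

(* Main.v *)
Require Import Defs.
From mathcomp Require Import all_boot all_order all_algebra.
From mathcomp Require Import reals.
From mathcomp Require Import mpoly.
From mathcomp Require Import ring lra zify.

(** The open invariants with exactly one boundary point are closed invariants by
    the open-closed relation, for eta a multiple of Delta_L, and all others
    vanish.

    For the closed invariants, let E_b be the difference of two theories in
    class b, and assume E_c = 0 for c < b. The quadratic terms of WDVV then cancel in
    class b, and E_b satisfies the linear relations
      E_b(uv, w, y, S) + E_b(wy, u, v, S) = E_b(vw, u, y, S) + E_b(uy, v, w, S).
    Taking v = h, these show by induction on the number of insertions that E_b
    vanishes as soon as some insertion is a power h^a with a <> 1; by the degree
    axiom, the only exception among few insertions is (h^(n-1), h^n) with b = 1,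
    which is the prescribed value. With the divisor axiom it remains to see that
    e = E_b(Delta_L, ..., Delta_L) vanishes, where the number l of insertions is
    forced by the degree. No linear relation involves e: it is reached through
    the quadratic terms in class b + 1. For (u, v, w, y) = (L, L, h, h^n) and
    S = L^(l-2) these give, with eps = (-1)^(n/2),
      eps (b + 1) E_(b+1)(h^n, h^n, L^(l-2)) = 2 (l - 2 - 2 b) e,
    while two further relations in class b + 1 make the left-hand side zero; and
    l = 2 b + 2 contradicts the degree axiom. *)

Set Implicit Arguments.
Unset Strict Implicit.
Unset Printing Implicit Defensive.

Import Order.TTheory GRing.Theory Num.Theory.
Local Open Scope ring_scope.

(** * Cohomology of the quadric *)

(** Taking a plain number lets exponents be added freely; the index is the intended one only for
    [k <= n], hence the bounds below. *)
Definition hidx (n k : nat) : 'I_n.+2 := inord k.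
Definition Lidx (n : nat) : 'I_n.+2 := ord_max.
Arguments Lidx {n}.

Lemma hidxE (n k : nat) : (k <= n)%N -> hidx n k = k :> nat.
Proof. by move=> kn; rewrite /hidx inordK //; lia. Qed.

Lemma hidx_eq (n i j : nat) :
  (i <= n)%N -> (j <= n)%N -> (hidx n i == hidx n j) = (i == j).
Proof. by move=> i_n j_n; rewrite -val_eqE /= !hidxE. Qed.

Lemma hidx_neqL (n i : nat) : (i <= n)%N -> (hidx n i == Lidx) = false.
Proof. by move=> i_n; rewrite -val_eqE /= hidxE //; lia. Qed.

Lemma idxP (n : nat) (i : 'I_n.+2) :
  i = Lidx \/ exists2 k, (k <= n)%N & i = hidx n k.
Proof.
have [i_n|n_i] := leqP i n; [right; exists (i : nat) => //|left];
  apply/val_inj => /=; first by rewrite hidxE.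
by have := ltn_ord i; lia.
Qed.

Lemma delta_deg_hidx (n k : nat) :
  (k <= n)%N -> delta_deg (hidx n k) = (2 * k)%N.
Proof. by move=> kn; rewrite /delta_deg hidxE // kn. Qed.

Lemma delta_deg_L (n : nat) : delta_deg (Lidx : 'I_n.+2) = n.
Proof. by rewrite /delta_deg ltnn. Qed.

(* The Poincare pairing matches h^k with h^(n-k) and Delta_L with itself. *)
Definition dual_idx (n : nat) (i : 'I_n.+2) : 'I_n.+2 :=
  if (i <= n)%N then hidx n (n - i) else i.

Lemma dual_hidx (n k : nat) :
  (k <= n)%N -> dual_idx (hidx n k) = hidx n (n - k).
Proof. by move=> kn; rewrite /dual_idx hidxE // kn. Qed.

Lemma dual_L (n : nat) : dual_idx (Lidx : 'I_n.+2) = Lidx.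
Proof. by rewrite /dual_idx ltnn. Qed.

Lemma dual_idxK (n : nat) : involutive (@dual_idx n).
Proof.
move=> i; case: (idxP i) => [->|[k kn ->]]; first by rewrite !dual_L.
by rewrite !dual_hidx ?leq_subr // subKn.
Qed.

Section Cohomology.
Variables (R : realType) (n : nat) (Q : quadric R n).
Hypothesis n_gt2 : (2 < n)%N.

Notation D i := (Delta Q i).
Notation H k := (Delta Q (hidx n k)).
Notation L := (Delta Q Lidx).

Lemma Delta_hidx (k : nat) : (k <= n)%N -> H k = hyp Q ^+ k.
Proof. by move=> kn; rewrite /Delta /delta hidxE // kn. Qed.

Lemma Delta_L : L = dualL Q.
Proof. by rewrite /Delta /delta ltnn. Qed.

Lemma Delta_of_deg (i : 'I_n.+2) : of_deg (delta_deg i) (D i).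
Proof.
exists (fun j => (j == i)%:R).
rewrite (bigD1 i) //= eqxx scale1r big1 ?addr0 // => j /andP[_ /negPf->].
by rewrite scale0r.
Qed.

Lemma of_deg_hyp (k : nat) : (k <= n)%N -> of_deg (2 * k) (hyp Q ^+ k).
Proof.
by move=> kn; rewrite -Delta_hidx // -(delta_deg_hidx kn); apply: Delta_of_deg.
Qed.

Lemma of_deg_L : of_deg n L.
Proof. by rewrite -[X in of_deg X](delta_deg_L n); apply: Delta_of_deg. Qed.

Lemma of_deg_big (d : nat) (A : coh Q) : (2 * n < d)%N -> of_deg d A -> A = 0.
Proof.
move=> nd [c ->]; rewrite big1 // => i /eqP di; move: di.
case: (idxP i) => [->|[k kn ->]]; rewrite ?delta_deg_L ?delta_deg_hidx //; lia.
Qed.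

(** By the grading, [h^n * h] lies in degree [2 * n + 2], above every basis class. *)
Lemma hyp_nilp (k : nat) : (n < k)%N -> hyp Q ^+ k = 0.
Proof.
move=> nk; rewrite -(subnKC nk) exprD exprSr.
suff -> : hyp Q ^+ n * hyp Q = 0 by rewrite mul0r.
have := coh_graded (of_deg_hyp (leqnn n)) (of_deg_hyp (ltnW (ltnW n_gt2))).
by rewrite expr1; apply: of_deg_big; lia.
Qed.

Lemma Delta_mulH (a b : nat) : (a <= n)%N -> (b <= n)%N ->
  H a * H b = if (a + b <= n)%N then H (a + b) else 0.
Proof.
move=> an bn; rewrite (Delta_hidx an) (Delta_hidx bn) -exprD.
case: leqP => [abn|/hyp_nilp//].
by rewrite Delta_hidx.
Qed.

Lemma Delta_mulHL (a : nat) : (0 < a <= n)%N -> H a * L = 0.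
Proof.
case: a => // a /= an; rewrite Delta_hidx // Delta_L exprSr -mulrA.
by rewrite hyp_dualL mulr0.
Qed.

Lemma Delta_mulLH (a : nat) : (0 < a <= n)%N -> L * H a = 0.
Proof. by rewrite mulrC; apply: Delta_mulHL. Qed.

Definition sgnL : R := (-1) ^+ n./2.

Lemma sgnL_sqr : sgnL * sgnL = 1.
Proof. by rewrite /sgnL -expr2 sqrr_sign. Qed.

(** Degree [2 * n] is spanned by [h^n] alone, and integration over X fixes the coefficient. *)
Lemma Delta_mulLL : L * L = sgnL *: H n.
Proof.
have [c cE] := coh_graded of_deg_L of_deg_L.
have {}cE : L * L = c (hidx n n) *: H n.
  rewrite cE (bigD1 (hidx n n)) /=; last first.
    by rewrite delta_deg_hidx // mul2n addnn.
  rewrite big1 ?addr0 // => i; case: (idxP i) => [->|[k kn ->]].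
    by rewrite delta_deg_L => /andP[/eqP]; lia.
  by rewrite delta_deg_hidx // hidx_eq //; lia.
have := intX_dualL Q; rewrite -Delta_L cE linearZ /= Delta_hidx // intX_hyp.
rewrite /sgnL => /(mulIf _) -> //.
by rewrite pnatr_eq0.
Qed.

Definition pair_wt (i : 'I_n.+2) : R := if i == Lidx then sgnL * 2 else 2.

Lemma intX_Delta (i j : 'I_n.+2) :
  intX Q (D i * D j) = pair_wt i *+ (j == dual_idx i).
Proof.
have hL k : (k <= n)%N -> intX Q (H k * L) = 0.
  case: k => [|k] kn; last by rewrite Delta_mulHL // linear0.
  rewrite Delta_hidx // mul1r; apply: (intX_deg of_deg_L); lia.
rewrite /pair_wt; case: (idxP i) => [->|[a an ->]];
  case: (idxP j) => [->|[b bn ->]].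
- by rewrite dual_L eqxx Delta_L intX_dualL.
- by rewrite dual_L hidx_neqL // mulrC hL.
- by rewrite dual_hidx // hidx_neqL // eq_sym hidx_neqL ?leq_subr // hL.
rewrite dual_hidx // hidx_neqL // hidx_eq ?leq_subr // !Delta_hidx // -exprD.
have [abn|nab|abn] := ltngtP (a + b) n.
- rewrite (intX_deg (of_deg_hyp (ltnW abn))); last by lia.
  by rewrite (_ : (b == n - a)%N = false) //; lia.
- rewrite hyp_nilp // linear0 (_ : (b == n - a)%N = false) //; lia.
- by rewrite abn intX_hyp (_ : (b == n - a)%N = true) //; lia.
Qed.

Lemma pair_wt_dual (i : 'I_n.+2) : pair_wt (dual_idx i) = pair_wt i.
Proof.
rewrite /pair_wt; case: (idxP i) => [->|[k kn ->]]; first by rewrite dual_L.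
by rewrite dual_hidx // !hidx_neqL // leq_subr.
Qed.

Lemma pair_wt_sqr (i : 'I_n.+2) : pair_wt i * pair_wt i = 4.
Proof.
rewrite /pair_wt; case: ifP => _; last by ring.
by rewrite mulrACA sgnL_sqr; ring.
Qed.

(** The Poincare matrix squares to 4, so its inverse is a quarter of itself. *)
Lemma invmx_poincare (m l : 'I_n.+2) :
  invmx (poincare_matrix Q) m l = pair_wt m / 4 *+ (l == dual_idx m).
Proof.
have gg : poincare_matrix Q *m poincare_matrix Q = 4%:M.
  apply/matrixP => i j; rewrite !mxE (bigD1 (dual_idx i)) //= !mxE.
  rewrite big1 ?addr0 => [|k /negPf ki]; last first.
    by rewrite !mxE intX_Delta ki mul0r.
  rewrite !intX_Delta eqxx dual_idxK pair_wt_dual mulr1n eq_sym.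
  by case: (i == j); rewrite ?mulr1n ?mulr0n ?mulr0 // pair_wt_sqr.
have /(@mulmx1_unit) [ug _] :
    poincare_matrix Q *m (4^-1 *: poincare_matrix Q) = 1.
  by rewrite -scalemxAr gg scale_scalar_mx mulVf // pnatr_eq0.
have -> : invmx (poincare_matrix Q) = 4^-1 *: poincare_matrix Q.
  apply: (can_inj (mulKmx ug)); rewrite mulmxV // -scalemxAr gg.
  by rewrite scale_scalar_mx mulVf // pnatr_eq0.
by rewrite !mxE intX_Delta mulrnAr mulrC.
Qed.

End Cohomology.

(** * WDVV for the coefficients of the potential *)

Local Notation U i := (U_(i)%MM).

Ltac mnm_ac := let i := fresh in
  apply/mnmP => i; rewrite !(mnmDE, mnm0E, mulmnE); lia.

(** * Multi-indices as sequences of insertions *)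

Section Multinomials.
Variable n : nat.
Implicit Types (r k : 'X_{1..n.+2}) (i : 'I_n.+2).

Definition index_seq r : seq 'I_n.+2 :=
  flatten [seq nseq (r i) i | i <- enum 'I_n.+2].

Lemma count_index_seq r i : count_mem i (index_seq r) = r i.
Proof.
rewrite count_flatten -map_comp sumnE big_map big_enum /=.
rewrite (bigD1 i) //= count_nseq /= eqxx mul1n big1 ?addn0 // => j /negPf ji.
by rewrite count_nseq /= ji.
Qed.

Lemma perm_index_seq r (s : seq 'I_n.+2) :
  (forall i, count_mem i s = r i) -> perm_eq (index_seq r) s.
Proof. by move=> sr; apply/allP => i _ /=; rewrite count_index_seq sr. Qed.

Lemma index_seqD1 r i : perm_eq (index_seq (r + U i)%MM) (i :: index_seq r).
Proof.
apply: perm_index_seq => j; rewrite /= count_index_seq mnmDE mnm1E addnC.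
by rewrite eq_sym.
Qed.

Lemma size_index_seq r : size (index_seq r) = mdeg r.
Proof.
rewrite size_flatten /shape -map_comp sumnE big_map big_enum /= mdegE.
by apply: eq_bigr => i _; rewrite /= size_nseq.
Qed.

Definition cohdeg r : nat := \sum_i r i * delta_deg i.

Lemma cohdegE r : cohdeg r = sumn [seq delta_deg i | i <- index_seq r].
Proof.
rewrite map_flatten sumn_flatten -2!map_comp sumnE big_map big_enum /=.
by apply: eq_bigr => i _; rewrite /= map_nseq sumn_nseq mulnC.
Qed.

Lemma cohdegD r k : cohdeg (r + k)%MM = (cohdeg r + cohdeg k)%N.
Proof.
by rewrite /cohdeg -big_split; apply: eq_bigr => i _; rewrite mnmDE mulnDl.
Qed.

Lemma cohdegU i : cohdeg (U i) = delta_deg i.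
Proof.
rewrite /cohdeg (bigD1 i) //= mnm1E eqxx mul1n big1 ?addn0 // => j /negPf ji.
by rewrite mnm1E eq_sym ji.
Qed.

Lemma mnm_splitU r i : (0 < r i)%N -> exists k, r = (k + U i)%MM.
Proof.
move=> ri; exists (r - U i)%MM; apply/mnmP => j.
by rewrite mnmDE mnmBE mnm1E; case: eqP => [<-|]; lia.
Qed.

End Multinomials.

(** * Products and derivatives of exponential generating series *)

Section Convolution.
Variables (R : realType) (N : nat).
Implicit Types (r k : 'X_{1..N}) (f g : 'X_{1..N} -> R).

Definition mfact r : R := (\prod_(i < N) (r i)`!)%:R.

Lemma mfact_neq0 r : mfact r != 0.
Proof. by rewrite pnatr_eq0 -lt0n; apply: prodn_gt0 => i; apply: fact_gt0. Qed.

Lemma mfact0 : mfact 0%MM = 1.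
Proof. by rewrite /mfact big1 // => i _; rewrite mnm0E. Qed.

Lemma mfactD1 r (i : 'I_N) : mfact (r + U i)%MM = (r i).+1%:R * mfact r.
Proof.
rewrite /mfact -natrM; congr _%:R.
rewrite (bigD1 i) //= (bigD1 i (P := xpredT)) //= mnmDE mnm1E eqxx addn1 factS.
rewrite mulnA; congr (_ * _)%N.
by apply: eq_bigr => j /negPf ji; rewrite mnmDE mnm1E eq_sym ji addn0.
Qed.

(** The coefficient of [t^r] in a product of two exponential generating series; the degree bounds
    only make the index set finite. *)
Definition conv f g r : R :=
  \sum_(k : 'X_{1..N < (mdeg r).+1, (mdeg r).+1} | r == (k.1 + k.2)%MM)
    f k.1 / mfact k.1 * (g k.2 / mfact k.2).

Lemma conv_single f g r (a a' : 'X_{1..N}) : r = (a + a')%MM ->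
  (forall k k', r = (k + k')%MM -> k != a -> f k * g k' = 0) ->
  conv f g r = f a * g a' / (mfact a * mfact a').
Proof.
move=> raa fg0.
have a_lt : (mdeg a < (mdeg r).+1)%N by rewrite raa mdegD ltnS leq_addr.
have a_lt' : (mdeg a' < (mdeg r).+1)%N by rewrite raa mdegD ltnS leq_addl.
rewrite /conv (bigD1 (BMultinom a_lt, BMultinom a_lt')) /=; last by apply/eqP.
rewrite big1 ?addr0; first by rewrite mulf_div.
move=> [k k'] /= /andP[/eqP rk kne]; rewrite mulf_div fg0 ?mul0r //.
apply: contra kne => /eqP ka; rewrite xpair_eqE -!val_eqE /= ka eqxx /=.
have -> : bmnm k' = a'; last by [].
apply/mnmP => i; have /mnmP/(_ i) := etrans (esym raa) rk.
by rewrite ka !mnmDE; lia.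
Qed.

Lemma conv_eq0 f g r :
  (forall k k', r = (k + k')%MM -> f k * g k' = 0) -> conv f g r = 0.
Proof.
move=> fg0; rewrite /conv big1 // => k /eqP rk.
by rewrite mulf_div fg0 ?mul0r.
Qed.

Lemma convBl f f' g r :
  conv (fun k => f k - f' k) g r = conv f g r - conv f' g r.
Proof.
rewrite /conv -sumrB; apply: eq_bigr => k _.
by rewrite -mulrBl -mulrBl.
Qed.

Lemma convBr f g g' r :
  conv f (fun k => g k - g' k) r = conv f g r - conv f g' r.
Proof.
rewrite /conv -sumrB; apply: eq_bigr => k _.
by rewrite -mulrBr -mulrBl.
Qed.

(** A partial derivative of an exponential series shifts the multi-index, the factor [(r i).+1]
    being absorbed by the factorial. *)
Lemma deriv_mfact (F : fps R N) (g : nat -> 'X_{1..N} -> R) (i : 'I_N) :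
  (forall b r, F b r = g b r / mfact r) ->
  forall b r, fps_deriv i F b r = g b (r + U i)%MM / mfact r.
Proof.
move=> Fg b r; rewrite /fps_deriv Fg mfactD1 -mulr_natr; field.
by rewrite mfact_neq0 nat1r pnatr_eq0.
Qed.

End Convolution.

(** * Axioms and WDVV in terms of coefficients *)

Section Potential.
Variables (R : realType) (n : nat) (Q : quadric R n).
Hypothesis n_gt2 : (2 < n)%N.

Notation D i := (Delta Q i).
Notation h := (hidx n).
Notation mnm := ('X_{1..n.+2}).
Implicit Types (F G : mnm -> R) (u v w y m : 'I_n.+2) (r s : mnm).

(** This is [F] with the class [D u * D v] as one more insertion: by Poincare duality, the factor
    before [F] is the coordinate of that product along [D (dual_idx m)]. *)
Definition cup_insert F u v s : R :=
  \sum_m pair_wt R m / 4 * intX Q (D u * D v * D m) * F (s + U (dual_idx m))%MM.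

Lemma cup_insertE F u v s (a : R) (k : 'I_n.+2) :
  D u * D v = a *: D k -> cup_insert F u v s = a * F (s + U k)%MM.
Proof.
move=> uv; rewrite /cup_insert (bigD1 (dual_idx k)) //= big1 ?addr0.
  rewrite uv -scalerAl linearZ /= intX_Delta // eqxx dual_idxK pair_wt_dual //.
  rewrite mulr1n /=; set x := F _; set p := pair_wt R k.
  by rewrite (_ : p / 4 * (a * p) * x = p * p / 4 * (a * x));
    [rewrite pair_wt_sqr divff ?mul1r // pnatr_eq0 | ring].
move=> i /negPf ik; rewrite uv -scalerAl linearZ /= intX_Delta // ik.
by rewrite scaler0 mulr0 mul0r.
Qed.

Lemma cup_insert_eq0 F u v s : D u * D v = 0 -> cup_insert F u v s = 0.
Proof.
by move=> uv; rewrite (@cup_insertE _ _ _ _ 0 u) ?mul0r // scale0r.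
Qed.

Lemma cup_insert0 F u v s :
  (forall m, F (s + U m)%MM = 0) -> cup_insert F u v s = 0.
Proof. by move=> F0; rewrite /cup_insert big1 // => m _; rewrite F0 mulr0. Qed.

Lemma cup_insertB F G u v s :
  cup_insert (fun r => F r - G r) u v s
    = cup_insert F u v s - cup_insert G u v s.
Proof. by rewrite -sumrB; apply: eq_bigr => m _; rewrite mulrBr. Qed.

(** One summand of a WDVV side, with the power of [T] in each factor fixed. *)
Definition split_sum F G u v w y r : R :=
  \sum_m pair_wt R m / 4 *
    conv (fun k => F (k + U u + U v + U m)%MM)
         (fun k => G (k + U (dual_idx m) + U w + U y)%MM) r.

Lemma split_sumBl F F' G u v w y r :
  split_sum (fun k => F k - F' k) G u v w y r
    = split_sum F G u v w y r - split_sum F' G u v w y r.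
Proof.
by rewrite -sumrB; apply: eq_bigr => m _; rewrite convBl mulrBr.
Qed.

Lemma split_sumBr F G G' u v w y r :
  split_sum F (fun k => G k - G' k) u v w y r
    = split_sum F G u v w y r - split_sum F G' u v w y r.
Proof.
by rewrite -sumrB; apply: eq_bigr => m _; rewrite convBr mulrBr.
Qed.

Lemma split_sum_eq0 F G u v w y r :
  (forall k k' m, r = (k + k')%MM -> F (k + U u + U v + U m)%MM = 0 \/
     G (k' + U (dual_idx m) + U w + U y)%MM = 0) ->
  split_sum F G u v w y r = 0.
Proof.
move=> FG0; rewrite /split_sum big1 // => m _; rewrite conv_eq0 ?mulr0 //.
by move=> k k' rk; case: (FG0 k k' m rk) => ->; rewrite ?mulr0 ?mul0r.
Qed.

Section Theory.
Variable GW : closed_family Q.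
Hypothesis GWt : closed_GW_theory GW.

Definition coefGW (b : nat) (r : mnm) : R := GW b%:Z (insertions Q r).
Notation G := coefGW.

Lemma GW_perm (b : nat) (r : mnm) (s : seq 'I_n.+2) :
  perm_eq (index_seq r) s -> GW b%:Z [seq D i | i <- s] = G b r.
Proof.
move=> rs; rewrite /G.
have -> : insertions Q r = [seq D i | i <- index_seq r].
  rewrite map_flatten -map_comp; congr flatten.
  by apply: eq_map => i /=; rewrite map_nseq.
by apply: (closed_symmetric GWt); rewrite perm_sym; apply: perm_map.
Qed.

Lemma GW_cons (b : nat) (r : mnm) (i : 'I_n.+2) :
  G b (r + U i)%MM = GW b%:Z (D i :: [seq D j | j <- index_seq r]).
Proof. by rewrite -(GW_perm _ (index_seqD1 r i)). Qed.

(** The degree axiom, contraposed and rearranged without subtraction. *)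
Lemma coefGW_degree (b : nat) (r : mnm) : G b r != 0 ->
  (2 * n + 2 * n * b + 2 * mdeg r = cohdeg r + 6)%N.
Proof.
move=> Gr; apply/eqP; apply: contraNT Gr => dr; apply/eqP.
rewrite -(GW_perm b (perm_refl _)).
apply: (closed_degree (closed_GW_axioms GWt)
  (d := [seq delta_deg i | i <- index_seq r])).
  split=> [|j]; rewrite !size_map // => jr.
  rewrite (nth_map Lidx) // (nth_map Lidx) //; apply: Delta_of_deg.
by rewrite size_map size_index_seq -cohdegE /chern1; lia.
Qed.

Lemma coefGW_unit (b : nat) (r : mnm) : (0 < b)%N -> G b (r + U (h 0))%MM = 0.
Proof.
move=> b0; rewrite GW_cons Delta_hidx // expr0.
by apply: (closed_unit (closed_GW_axioms GWt)); lia.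
Qed.

Lemma coefGW_divisor (b : nat) (r : mnm) :
  (0 < b)%N -> G b (r + U (h 1))%MM = b%:R * G b r.
Proof.
move=> b0; rewrite GW_cons.
rewrite (closed_symmetric GWt b%:Z
    (t := rcons [seq D j | j <- index_seq r] (D (h 1))));
  last by rewrite perm_sym perm_rcons.
have n1 : (1 <= n)%N by lia.
rewrite (closed_divisor (closed_GW_axioms GWt)); last 1 first.
- by lia.
- rewrite (GW_perm b (perm_refl _)) /pairing Delta_hidx // expr1 int_line_hyp.
  by rewrite mulr1.
by have := Delta_of_deg Q (h 1); rewrite delta_deg_hidx.
Qed.

Lemma coefGW0 (r : mnm) : mdeg r != 3%N -> G 0 r = 0.
Proof.
move=> r3; rewrite -(GW_perm 0 (perm_refl _)).
by apply: (closed_zero (closed_GW_axioms GWt)); rewrite size_map size_index_seq.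
Qed.

Lemma coefGW0_3 u v m : G 0 (U u + U v + U m)%MM = intX Q (D u * D v * D m).
Proof.
rewrite -(closed_zero3 (closed_GW_axioms GWt)) -(@GW_perm 0 _ [:: u; v; m]) //.
by apply: perm_index_seq => i; rewrite /= !mnmDE !mnm1E addn0 addnA.
Qed.

Lemma coefGW_initial : G 1 (U (h n.-1) + U (h n))%MM = 4.
Proof.
rewrite -(closed_initial GWt) -(@GW_perm 1 _ [:: h n.-1; h n]) //.
by apply: perm_index_seq => i; rewrite /= !mnmDE !mnm1E addn0.
Qed.

Lemma deriv3_potential u v m (b : nat) (r : mnm) :
  fps_deriv u (fps_deriv v (fps_deriv m (potential GW))) b r
    = G b (r + U u + U v + U m)%MM / mfact R r.
Proof.
have E0 c s : potential GW c s = G c s / mfact R s by [].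
exact: (deriv_mfact u (deriv_mfact v (deriv_mfact m E0))).
Qed.

Lemma wdvv_sideE u v w y (b : nat) (r : mnm) :
  wdvv_side GW u v w y b r
    = \sum_(c < b.+1) split_sum (G c) (G (b - c)%N) u v w y r.
Proof.
rewrite /wdvv_side /split_sum [RHS]exchange_big; apply: eq_bigr => m _ /=.
rewrite (bigD1 (dual_idx m)) //= big1 ?addr0; last first.
  by move=> l /negPf lm; rewrite invmx_poincare // lm mul0r.
rewrite invmx_poincare // eqxx mulr1n /fps_mul mulr_sumr.
apply: eq_bigr => c _; congr (_ * _); apply: eq_bigr => k _.
by rewrite !deriv3_potential.
Qed.

(** The class 0 factor already has its three insertions [u], [v], [m], so all of [r] goes to the
    other factor. *)
Lemma split_sum0l F u v w y (r : mnm) :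
  split_sum (G 0) F u v w y r = cup_insert F u v (r + U w + U y)%MM / mfact R r.
Proof.
rewrite /split_sum /cup_insert mulr_suml; apply: eq_bigr => m _.
rewrite (conv_single (a := 0%MM) (a' := r)) ?add0m //.
  rewrite coefGW0_3 mfact0 mul1r !mulrA; congr (_ * F _ / _); mnm_ac.
move=> k k' _ k0; rewrite coefGW0 ?mul0r // !mdegD !mdeg1.
by move: k0; rewrite -mdeg_eq0; lia.
Qed.

Lemma split_sum0r F u v w y (r : mnm) :
  split_sum F (G 0) u v w y r = cup_insert F w y (r + U u + U v)%MM / mfact R r.
Proof.
rewrite /split_sum /cup_insert mulr_suml (reindex_inj (inv_inj (@dual_idxK n))).
apply: eq_bigr => m _ /=; rewrite dual_idxK pair_wt_dual.
rewrite (conv_single (a := r) (a' := 0%MM)) ?addm0 //.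
  rewrite (_ : (0 + U m + U w + U y = U w + U y + U m)%MM); last by mnm_ac.
  by rewrite coefGW0_3 mfact0 mulr1; ring.
move=> k k' rk kr; rewrite [G 0 _]coefGW0 ?mulr0 // !mdegD !mdeg1.
suff : mdeg k' != 0%N by lia.
rewrite mdeg_eq0; apply: contra kr => /eqP k0.
by rewrite rk k0 addm0.
Qed.

(* The summands with a constant factor contain three-point classical
   intersection numbers and reduce to insertions of cup products. *)
Lemma wdvv_expand u v w y (b : nat) (r : mnm) : (0 < b)%N ->
  cup_insert (G b) u v (r + U w + U y)%MM
    + cup_insert (G b) w y (r + U u + U v)%MM
    + mfact R r *
      (\sum_(1 <= c < b) split_sum (G c) (G (b - c)%N) u v w y r)
  = cup_insert (G b) v w (r + U u + U y)%MM
    + cup_insert (G b) u y (r + U v + U w)%MM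
    + mfact R r *
      (\sum_(1 <= c < b) split_sum (G c) (G (b - c)%N) v w u y r).
Proof.
move=> b0; have := closed_WDVV GWt u v w y b r; rewrite !wdvv_sideE.
rewrite -!(big_mkord xpredT (fun c => split_sum (G c) (G (b - c)%N) _ _ _ _ r)).
rewrite !(@big_ltn _ _ _ 0) // !big_nat_recr //= !subn0 !subnn.
rewrite !split_sum0l !split_sum0r.
move/(congr1 (fun x => mfact R r * x)); rewrite !mulrDr.
rewrite !(mulrC (mfact R r) (_ / _)) !divfK ?mfact_neq0 // => E.
by rewrite addrAC -addrA E -!addrA; congr (_ + _); rewrite addrC.
Qed.

Lemma coefGW1_nhn : G 1 (U (h n.-1) + U (h 1) + U (h n))%MM = 4.
Proof.
rewrite (_ : _ + _ = U (h n.-1) + U (h n) + U (h 1))%MM; last by mnm_ac.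
by rewrite coefGW_divisor // coefGW_initial mul1r.
Qed.

(** WDVV for [(h^(n-1), h, Delta_L, Delta_L)] in class 1, where there are no quadratic terms, links
    this value to the prescribed 4. *)
Lemma coefGW1_LLn : G 1 (U Lidx + U Lidx + U (h n))%MM = - (4 * sgnL R n).
Proof.
have n1 : (1 <= n)%N by lia.
have n'n : (n.-1 <= n)%N by lia.
have := wdvv_expand (h n.-1) (h 1) Lidx Lidx 0%MM (ltn0Sn 0).
rewrite !big_geq // !mulr0 !addr0 !add0m.
rewrite (@cup_insertE _ _ _ _ 1 (h n)); last first.
  by rewrite Delta_mulH // (_ : (n.-1 + 1)%N = n) ?leqnn ?scale1r //; lia.
rewrite mul1r (cup_insertE _ _ (Delta_mulLL Q n_gt2)) coefGW1_nhn.
rewrite !cup_insert_eq0 ?Delta_mulHL //; last by lia.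
by move/eqP; rewrite addr0 addr_eq0 mulrC => /eqP.
Qed.

End Theory.
End Potential.

(** * The difference of two closed theories *)

Section Difference.
Variables (R : realType) (n : nat) (Q : quadric R n).
Hypothesis n_gt2 : (2 < n)%N.
Variables GW GW' : closed_family Q.
Hypothesis GWt : closed_GW_theory GW.
Hypothesis GWt' : closed_GW_theory GW'.

Notation mnm := ('X_{1..n.+2}).
Notation h := (hidx n).
Notation L := (@Lidx n).
Notation G := (coefGW GW).
Notation G' := (coefGW GW').
Notation cup := (cup_insert Q).

Definition diffGW (b : nat) (r : mnm) : R := G b r - G' b r.
Notation E := diffGW.

Lemma diffGW_degree (b : nat) (r : mnm) :
  (2 * n + 2 * n * b + 2 * mdeg r)%N <> (cohdeg r + 6)%N -> E b r = 0.
Proof.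
move=> dr; rewrite /E.
have [->|/(coefGW_degree n_gt2 GWt)//] := eqVneq (G b r) 0.
have [->|/(coefGW_degree n_gt2 GWt')//] := eqVneq (G' b r) 0.
by rewrite subr0.
Qed.

Lemma diffGW_unit (b : nat) (r : mnm) :
  (0 < b)%N -> E b (r + U (h 0))%MM = 0.
Proof. by move=> b0; rewrite /E !coefGW_unit // subr0. Qed.

Lemma diffGW_divisor (b : nat) (r : mnm) :
  (0 < b)%N -> E b (r + U (h 1))%MM = b%:R * E b r.
Proof. by move=> b0; rewrite /E !coefGW_divisor // mulrBr. Qed.

Lemma diffGW_initial : E 1 (U (h n.-1) + U (h n))%MM = 0.
Proof. by rewrite /E !coefGW_initial // subrr. Qed.

Lemma diffGW0 (r : mnm) : E 0 r = 0.
Proof.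
rewrite /E; have [r3|r3] := eqVneq (mdeg r) 3; last first.
  by rewrite !coefGW0 // subr0.
have [i ri] : exists i, (0 < r i)%N.
  apply/existsP; apply: contra_eqT r3 => /existsPn r0.
  by rewrite mdegE big1 // => i _; have := r0 i; lia.
have [r' r'E] := mnm_splitU ri.
have r'2 : mdeg r' = 2%N by move: r3; rewrite r'E mdegD mdeg1; lia.
have [j rj] : exists j, (0 < r' j)%N.
  apply/existsP; apply: contra_eqT r'2 => /existsPn r0.
  by rewrite mdegE big1 // => k _; have := r0 k; lia.
have [r'' r''E] := mnm_splitU rj.
have /eqP : mdeg r'' = 1%N by move: r'2; rewrite r''E mdegD mdeg1; lia.
rewrite mdeg_eq1 => /existsP[k /eqP kE].
by rewrite r'E r''E kE !coefGW0_3 // subrr.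
Qed.

(** * The difference in class [b], given that it vanishes in all smaller classes *)

Section Level.
Variable b : nat.
Hypothesis b_gt0 : (0 < b)%N.
Hypothesis E_lt : forall c, (c < b)%N -> forall r, E c r = 0.

(** The bilinear identity [F G - F' G' = (F - F') G + F' (G - G')]. *)
Lemma split_sum_diff (B c : nat) u v w y (r : mnm) :
  split_sum (G c) (G (B - c)%N) u v w y r
    - split_sum (G' c) (G' (B - c)%N) u v w y r
  = split_sum (E c) (G (B - c)%N) u v w y r
    + split_sum (G' c) (E (B - c)%N) u v w y r.
Proof.
rewrite [X in _ = X + _]split_sumBl [X in _ = _ + X]split_sumBr.
by rewrite addrA subrK.
Qed.

Lemma split_sum_Elt0 (c : nat) F u v w y (r : mnm) :
  (c < b)%N -> split_sum (E c) F u v w y r = 0.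
Proof. by move=> cb; apply: split_sum_eq0 => k k' m _; left; apply: E_lt. Qed.

Lemma split_sum_Egt0 (c : nat) F u v w y (r : mnm) :
  (c < b)%N -> split_sum F (E c) u v w y r = 0.
Proof. by move=> cb; apply: split_sum_eq0 => k k' m _; right; apply: E_lt. Qed.

(** Both factors of a quadratic term have class between 1 and [b - 1], where the two theories
    agree. *)
Lemma diff_wdvv u v w y (r : mnm) :
  cup (E b) u v (r + U w + U y)%MM + cup (E b) w y (r + U u + U v)%MM
  = cup (E b) v w (r + U u + U y)%MM + cup (E b) u y (r + U v + U w)%MM.
Proof.
have := wdvv_expand n_gt2 GWt u v w y r b_gt0.
have := wdvv_expand n_gt2 GWt' u v w y r b_gt0.
have S0 u1 v1 w1 y1 :
  \sum_(1 <= c < b) split_sum (G c) (G (b - c)%N) u1 v1 w1 y1 r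
  = \sum_(1 <= c < b) split_sum (G' c) (G' (b - c)%N) u1 v1 w1 y1 r.
  apply/eqP; rewrite -subr_eq0 -sumrB big_nat big1 // => c /andP[c0 cb].
  by rewrite split_sum_diff split_sum_Elt0 // split_sum_Egt0 ?addr0 //; lia.
rewrite !S0 !cup_insertB; lra.
Qed.

(** In class [b + 1] the differences of quadratic terms survive only with [E b] as one factor, so
    the other factor has class 1. *)
Lemma diff_wdvvS u v w y (r : mnm) :
  cup (E b.+1) u v (r + U w + U y)%MM + cup (E b.+1) w y (r + U u + U v)%MM
    + mfact R r * (split_sum (E b) (G 1) u v w y r
                   + split_sum (G' 1) (E b) u v w y r)
  = cup (E b.+1) v w (r + U u + U y)%MM + cup (E b.+1) u y (r + U v + U w)%MM
    + mfact R r * (split_sum (E b) (G 1) v w u y r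
                   + split_sum (G' 1) (E b) v w u y r).
Proof.
have := wdvv_expand n_gt2 GWt u v w y r (ltn0Sn b).
have := wdvv_expand n_gt2 GWt' u v w y r (ltn0Sn b).
have S0 u1 v1 w1 y1 :
  \sum_(1 <= c < b.+1) split_sum (G c) (G (b.+1 - c)%N) u1 v1 w1 y1 r
  = \sum_(1 <= c < b.+1) split_sum (G' c) (G' (b.+1 - c)%N) u1 v1 w1 y1 r
    + (split_sum (E b) (G 1) u1 v1 w1 y1 r
       + split_sum (G' 1) (E b) u1 v1 w1 y1 r).
  apply/eqP; rewrite addrC -subr_eq -sumrB; apply/eqP.
  under eq_bigr do rewrite split_sum_diff.
  rewrite big_split big_nat_recr //= subSnn; congr (_ + _).
    rewrite big_nat big1 ?add0r // => c /andP[c0 cb].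
    by rewrite split_sum_Elt0.
  rewrite big_ltn // subn1 /= big_nat big1 ?addr0 // => c /andP[c0 cb].
  by rewrite split_sum_Egt0 //; lia.
rewrite !S0 !cup_insertB !mulrDr.
set M := mfact R r; lra.
Qed.


(** For at most two insertions, the degree axiom leaves only [(h^(n-1), h^n)] in class 1, the
    prescribed value. *)
Lemma diffGW_small (r : mnm) i : i != h 1 -> i != L ->
  (0 < r i)%N -> (mdeg r <= 2)%N -> E b r = 0.
Proof.
move=> i1 iL /mnm_splitU[s ->]; rewrite mdegD mdeg1 => s1.
have [k [kn kE]] : exists k, (k <= n)%N /\ i = h k.
  by case: (idxP i) => [iE|[k kn ->]]; [rewrite iE eqxx in iL | exists k].
have [s0|s_neq0] := eqVneq s 0%MM.
  apply: diffGW_degree; rewrite s0 add0m mdeg1 cohdegU kE delta_deg_hidx //.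
  nia.
have /eqP : mdeg s = 1%N by move: s_neq0; rewrite -mdeg_eq0; lia.
rewrite mdeg_eq1 => /existsP[j /eqP ->] {s s1 s_neq0}.
have [b1|b1] := ltnP 1 b.
  apply: diffGW_degree; rewrite mdegD !mdeg1 cohdegD !cohdegU kE.
  case: (idxP j) => [->|[a an ->]]; 
    rewrite ?delta_deg_L !delta_deg_hidx //; nia.
have {b1} b1 : b = 1%N by lia.
rewrite b1 kE; have [jE|[a an jE]] := idxP j.
  (* The degrees would force [2 k = 3 n - 2], impossible for [k <= n] since [n > 2]. *)
  apply: diffGW_degree; rewrite mdegD !mdeg1 cohdegD !cohdegU jE.
  rewrite delta_deg_L delta_deg_hidx //; lia.
have [akn|akn] := eqVneq (a + k)%N (n + n.-1)%N; last first.
  apply: diffGW_degree; rewrite mdegD !mdeg1 cohdegD !cohdegU jE.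
  rewrite !delta_deg_hidx //; lia.
have [an'|an'] := eqVneq a n.
  by rewrite addmC jE an' (_ : k = n.-1) ?diffGW_initial //; lia.
rewrite jE; have -> : k = n by lia.
have -> : a = n.-1 by lia.
exact: diffGW_initial.
Qed.

(** * Induction on the number of insertions, one of them a power of [h] other than [h] *)

Section Insertions.
Variable l : nat.
Hypothesis E_fewer : forall s i, i != h 1 -> i != L ->
  ((mdeg s).+1 < l)%N -> E b (s + U i)%MM = 0.

Lemma E_fewer_h (s : mnm) k :
  (1 < k <= n)%N -> ((mdeg s).+1 < l)%N -> E b (s + U (h k))%MM = 0.
Proof.
by move=> k1 sl; apply: E_fewer; rewrite ?hidx_neqL ?hidx_eq //; lia.
Qed.

(* The WDVV relation in direction h moves a power of h from one insertion to
   another, until it becomes a divisor. *)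
Lemma diffGW_hh (s : mnm) (k : 'I_n.+2) i j : (mdeg s).+3 = l ->
  (0 < i <= n)%N -> (1 < j <= n)%N -> E b (s + U k + U (h i) + U (h j))%MM = 0.
Proof.
move=> sl; elim: i j => [|a IHa] j; first by lia.
have n1 : (1 <= n)%N by lia.
case: a IHa => [|a] IHa an jn.
  rewrite (_ : _ + _ = s + U k + U (h j) + U (h 1))%MM; last by mnm_ac.
  by rewrite diffGW_divisor // E_fewer_h ?mulr0 // mdegD mdeg1; lia.
have aP : (a.+1 <= n)%N by lia.
have jP : (j <= n)%N by lia.
have := diff_wdvv (h a.+1) (h 1) (h j) k s.
rewrite (@cup_insertE _ _ _ n_gt2 _ _ _ _ 1 (h a.+2)); last first.
  by rewrite Delta_mulH // addn1; case: leqP; rewrite ?scale1r //; lia.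
rewrite mul1r (_ : s + U (h j) + U k + U (h a.+2)
                 = s + U k + U (h a.+2) + U (h j))%MM; last by mnm_ac.
have -> : cup (E b) (h a.+1) k (s + U (h 1) + U (h j))%MM = 0.
  apply: cup_insert0 => m.
  rewrite (_ : _ + _ = s + U m + U (h j) + U (h 1))%MM; last by mnm_ac.
  by rewrite diffGW_divisor // E_fewer_h ?mulr0 // mdegD mdeg1; lia.
have -> : cup (E b) (h j) k (s + U (h a.+1) + U (h 1))%MM = 0.
  case: (idxP k) => [->|[c cn ->]].
    by apply: cup_insert_eq0 => //; rewrite Delta_mulHL //; lia.
  have := Delta_mulH Q n_gt2 jP cn; case: leqP => [jcn|_] jc; last first.
    exact: cup_insert_eq0.
  rewrite (@cup_insertE _ _ _ n_gt2 _ _ _ _ 1 (h (j + c))) ?scale1r // mul1r.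
  rewrite (_ : _ + _ = s + U (h a.+1) + U (h (j + c)) + U (h 1))%MM;
    last by mnm_ac.
  by rewrite diffGW_divisor // E_fewer_h ?mulr0 // ?mdegD ?mdeg1; lia.
(* What remains is [E(h^(a+2), h^j) = E(h^(a+1), h^(j+1))], other insertions fixed: the two terms
   removed contain the divisor [h] and reduce to fewer insertions, or contain a zero product. *)
rewrite !addr0 => ->.
have := Delta_mulH Q n_gt2 n1 jP; case: ifP => [jn1|_] j1; last first.
  by apply: cup_insert_eq0.
rewrite (@cup_insertE _ _ _ n_gt2 _ _ _ _ 1 (h (1 + j))) ?scale1r // mul1r.
rewrite (_ : _ + _ = s + U k + U (h a.+1) + U (h (1 + j)))%MM; last by mnm_ac.
by apply: IHa; lia.
Qed.

(** In WDVV for [(h^(i-1), h, Delta_L, Delta_L)] the right-hand side vanishes because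
    [h * Delta_L = 0], and the term from [Delta_L^2] contains [h^n] and the divisor [h], so it
    reduces to fewer insertions. *)
Lemma diffGW_LL (s : mnm) i : (mdeg s).+3 = l -> (1 < i <= n)%N ->
  E b (s + U L + U L + U (h i))%MM = 0.
Proof.
move=> sl; case: i => [|[|a]] // an.
have := diff_wdvv (h a.+1) (h 1) L L s.
have n1 : (1 <= n)%N by lia.
rewrite (@cup_insertE _ _ _ n_gt2 _ _ _ _ 1 (h a.+2)); last first.
  rewrite Delta_mulH // ?addn1; last by lia.
  by case: leqP; rewrite ?scale1r //; lia.
rewrite mul1r (@cup_insertE _ _ _ n_gt2 _ _ _ _ _ _ (Delta_mulLL Q n_gt2)).
rewrite !cup_insert_eq0 ?Delta_mulHL //; last by lia.
rewrite (_ : s + U (h a.+1) + U (h 1) + U (h n)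
           = s + U (h a.+1) + U (h n) + U (h 1))%MM; last by mnm_ac.
rewrite diffGW_divisor // (E_fewer_h (k := n)) ?mdegD ?mdeg1; [|lia..].
by rewrite !mulr0 !addr0.
Qed.

End Insertions.

Lemma diffGW_higher (r : mnm) i :
  i != h 1 -> i != L -> (0 < r i)%N -> E b r = 0.
Proof.
have [l] := ubnP (mdeg r); elim: l r i => // l IHl r i rl i1 iL ri.
have [r2|r2] := leqP (mdeg r) 2; first exact: diffGW_small ri r2.
have [k [kn kE]] : exists k, (k <= n)%N /\ i = h k.
  by case: (idxP i) => [iE|[k kn ->]]; [rewrite iE eqxx in iL | exists k].
have [s rE] := mnm_splitU ri.
have sr : (mdeg s).+1 = mdeg r by rewrite rE mdegD mdeg1 addn1.
have Ef s' i' : i' != h 1 -> i' != L ->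
    ((mdeg s').+1 < mdeg r)%N -> E b (s' + U i')%MM = 0.
  move=> i1' iL' sr'; apply: (IHl _ i') => //;
    first by rewrite mdegD mdeg1; lia.
  by rewrite mnmDE mnm1E eqxx addn1.
have [k0|k0] := eqVneq k 0%N; first by rewrite rE kE k0 diffGW_unit.
have k1 : (1 < k <= n)%N by move: i1; rewrite kE hidx_eq //; lia.
(* If another insertion is a power of [h], the unit axiom or [diffGW_hh] applies; otherwise the
   others, at least two, are all [Delta_L], and [diffGW_LL] applies. *)
have [/existsP[j /andP[jL sj]]|] := boolP [exists j, (j != L) && (0 < s j)%N].
  have [s' sE] := mnm_splitU sj.
  have s'r : (mdeg s').+2 = mdeg r by rewrite -sr sE mdegD mdeg1 addn1.
  have [m s'm] : exists m, (0 < s' m)%N.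
    apply/existsP; apply: contraLR r2 => /existsPn s0.
    by rewrite -s'r mdegE big1 // => m _; have := s0 m; lia.
  have [t s'E] := mnm_splitU s'm.
  case: (idxP j) => [jE|[a an jE]]; first by rewrite jE eqxx in jL.
  have [a0|a0] := eqVneq a 0%N.
    rewrite rE sE jE a0 (_ : _ + _ = s' + U i + U (h 0))%MM; last by mnm_ac.
    exact: diffGW_unit.
  rewrite rE sE s'E jE kE; apply: (diffGW_hh Ef); [|lia|lia].
  by rewrite -s'r s'E mdegD mdeg1 addn1.
rewrite negb_exists => /forallP s0.
have sL j : j != L -> s j = 0%N by move=> jL; have := s0 j; rewrite jL /=; lia.
have sLE : mdeg s = s L.
  by rewrite mdegE (bigD1 L) //= big1 ?addn0 // => j /sL.
have [s' sE] : exists s', s = (s' + U L + U L)%MM.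
  have [t tE] : exists t, s = (t + U L)%MM by apply: mnm_splitU; lia.
  have [t' t'E] : exists t', t = (t' + U L)%MM.
    by apply: mnm_splitU; have := congr1 (fun x : mnm => x L) tE;
      rewrite mnmDE mnm1E eqxx; lia.
  by exists t'; rewrite tE t'E.
rewrite rE sE kE; apply: (diffGW_LL Ef) => //.
by rewrite -sr sE !mdegD !mdeg1; lia.
Qed.


(** Only [h] and [Delta_L] can occur, by [diffGW_higher], and each [h] adds 2 to both sides of the
    degree equation. *)
Lemma diffGW_L_degree (r : mnm) :
  E b r != 0 -> (2 * n * b.+1 + 2 * r L = n * r L + 6)%N.
Proof.
move=> Er; have r0 i : i != L -> i != h 1 -> r i = 0%N.
  move=> iL i1; apply/eqP; rewrite -leqn0 leqNgt; apply: contraNN Er => ri.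
  by rewrite (diffGW_higher i1 iL ri).
have n1 : (1 <= n)%N by lia.
have [|/eqP] := eqVneq (2 * n + 2 * n * b + 2 * mdeg r)%N (cohdeg r + 6)%N;
  last by move=> /diffGW_degree Er0; rewrite Er0 eqxx in Er.
have -> : mdeg r = (r L + r (h 1))%N.
  rewrite mdegE (bigD1 L) //= (bigD1 (h 1)) ?hidx_neqL //= big1 ?addn0 //.
  by move=> i /andP[iL i1]; rewrite r0.
have -> : cohdeg r = (r L * n + r (h 1) * 2)%N.
  rewrite /cohdeg (bigD1 L) //= (bigD1 (h 1)) ?hidx_neqL //= big1 ?addn0.
    by rewrite delta_deg_L delta_deg_hidx.
  by move=> i /andP[iL i1]; rewrite r0.
lia.
Qed.

Ltac count_L := rewrite !(mnmDE, mnm0E, mulmnE, mnm1E) ?hidx_neqL ?eqxx; lia.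

(** * Insertions of [Delta_L] only, reached through class [b + 1] *)

Section PureL.
Variable p : nat.
Hypothesis deg_p : (2 * n * b.+1 + 2 * p.+4 = n * p.+4 + 6)%N.

(** As [n > 2], the degree equation admits a single number of copies of [Delta_L]. *)
Lemma diffGW_countL (r : mnm) : r L != p.+4 -> E b r = 0.
Proof.
move=> rL; apply/eqP; apply: contraNT rL => /diffGW_L_degree; nia.
Qed.

Lemma diffGW_ltL (r : mnm) : (r L < p.+4)%N -> E b r = 0.
Proof. by move=> rp; apply: diffGW_countL; rewrite neq_ltn rp. Qed.

Lemma diffGW_hk k (r : mnm) : (1 < k <= n)%N -> (0 < r (h k))%N -> E b r = 0.
Proof.
by move=> k1 rk; apply: (diffGW_higher (i := h k)) => //;
  rewrite ?hidx_neqL ?hidx_eq //; lia.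
Qed.

(** Two values of [m] contribute. For [Delta_L], one of the [p + 2] copies in [r] joins the class 1
    factor, which is [-4 eps]. For [h], all of [r] stays in [E b], whose divisor gives [b], and the
    class 1 factor is 4. *)
Lemma split_sum_pureL :
  let r := (U L *+ p.+2)%MM in
  mfact R r * split_sum (E b) (G 1) L L (h 1) (h n) r
    = (2 * b%:R - 2 * p.+2%:R) * E b (U L *+ p.+4)%MM.
Proof.
set e := E b (U L *+ p.+4)%MM => r.
have n1 : (1 <= n)%N by lia.
have rk k k' i : r = (k + k')%MM -> i != L -> k i = 0%N.
  move=> rE iL; have := congr1 (fun x : mnm => x i) rE.
  by rewrite /r mnmDE mulmnE mnm1E eq_sym (negPf iL); lia.
have kE k k' q : r = (k + k')%MM -> k L = q -> k = (U L *+ q)%MM.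
  move=> rE kq; apply/mnmP => i; rewrite mulmnE mnm1E.
  by case: eqVneq => [<-|]; [rewrite mul1n | rewrite eq_sym => /(rk _ _ _ rE)].
rewrite /split_sum (bigD1 L) //= (bigD1 (h 1)) ?hidx_neqL //=.
rewrite big1 ?addr0 => [|m /andP[mL m1]]; last first.
  rewrite conv_eq0 ?mulr0 // => k k' _; rewrite (diffGW_higher m1 mL) ?mul0r //.
  by rewrite !mnmDE !mnm1E eqxx; lia.
rewrite (conv_single (a := (U L *+ p.+1)%MM) (a' := U L)); last first.
- move=> k k' rE ka; rewrite diffGW_countL ?mul0r //.
  apply: contra ka => /eqP kL; apply/eqP; apply: (kE _ _ _ rE).
  by move: kL; count_L.
- by rewrite /r; mnm_ac.
rewrite (conv_single (a := r) (a' := 0%MM)) ?addm0 //; last first.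
  move=> k k' rE ka; rewrite diffGW_countL ?mul0r //.
  apply: contra ka => /eqP kL; apply/eqP; apply: (kE _ _ _ rE).
  by move: kL; count_L.
rewrite dual_L dual_hidx // subn1.
rewrite (_ : (_ *+ p.+1 + _ + _ + _ = U L *+ p.+4)%MM); last by mnm_ac.
rewrite (_ : (U L + U L + U (h 1) + U (h n)
   = U L + U L + U (h n) + U (h 1))%MM); last by mnm_ac.
rewrite (_ : (r + _ + _ + _ = U L *+ p.+4 + U (h 1))%MM); last first.
  by rewrite /r; mnm_ac.
rewrite add0m !(coefGW_divisor n_gt2 GWt) // coefGW1_LLn // coefGW1_nhn //.
rewrite diffGW_divisor // -/e.
have -> : mfact R (U L) = 1 :> R.
  by rewrite -[U L]add0m mfactD1 mfact0 mnm0E mulr1.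
have -> : mfact R r = p.+2%:R * mfact R (U L *+ p.+1)%MM.
  rewrite (_ : r = U L *+ p.+1 + U L)%MM; last by rewrite /r; mnm_ac.
  by rewrite mfactD1 mulmnE mnm1E eqxx mul1n.
have p0 : p.+2%:R != 0 :> R by rewrite pnatr_eq0.
rewrite mfact0 /pair_wt eqxx hidx_neqL // mulr1.
move: (mfact R _) (mfact_neq0 R (U L *+ p.+1)%MM) => x x0.
move: (p.+2%:R) p0 (sgnL R n) (sgnL_sqr R n) => q q0 s ss.
(* One sign [s] comes from [pair_wt], the other from [coefGW1_LLn]. *)
transitivity (2 * b%:R * e - 2 * q * e * (s * s)); last by rewrite ss; ring.
by field; rewrite x0 q0.
Qed.

(** The factor [E b] reaches [p + 4] copies of [Delta_L] only if [m] is [Delta_L] and all of [r]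
    goes to it. *)
Lemma split_sum_pureL_swap :
  let r := (U L *+ p.+2)%MM in
  mfact R r * split_sum (E b) (G 1) L (h 1) L (h n) r
    = - (2 * b%:R * E b (U L *+ p.+4)%MM).
Proof.
set e := E b (U L *+ p.+4)%MM => r.
have n1 : (1 <= n)%N by lia.
rewrite /split_sum (bigD1 L) //= big1 ?addr0 => [|m mL]; last first.
  rewrite conv_eq0 ?mulr0 // => k k' rE; rewrite diffGW_ltL ?mul0r //.
  have := congr1 (fun x : mnm => x L) rE; rewrite /r; move: mL.
  by rewrite !(mnmDE, mulmnE, mnm1E) hidx_neqL // eqxx => /negPf->; lia.
rewrite (conv_single (a := r) (a' := 0%MM)) ?addm0 //; last first.
  move=> k k' rE ka; rewrite diffGW_ltL ?mul0r //.
  have : k' L != 0%N.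
    apply: contra ka => /eqP k'L; apply/eqP/mnmP => i.
    rewrite rE mnmDE; have [->|iL] := eqVneq i L; first by rewrite k'L addn0.
    have := congr1 (fun x : mnm => x i) rE.
    by rewrite /r mnmDE mulmnE mnm1E eq_sym (negPf iL); lia.
  by have := congr1 (fun x : mnm => x L) rE; rewrite /r; count_L.
rewrite dual_L add0m coefGW1_LLn //.
rewrite (_ : (r + _ + _ + _ = U L *+ p.+4 + U (h 1))%MM); last first.
  by rewrite /r; mnm_ac.
rewrite diffGW_divisor // -/e mfact0 mulr1 /pair_wt eqxx.
have := mfact_neq0 R r; set x := mfact R r => x0.
have := sgnL_sqr R n; set s := sgnL R n => ss.
transitivity (- (2 * b%:R * e * (s * s))); last by rewrite ss mulr1.
by field.
Qed.

(** Two relations in class [b + 1] suffice; their quadratic terms vanish because [E b] receives too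
    few copies of [Delta_L] or an insertion [h^(n-1)]. *)
Lemma diffGW_nextL : E b.+1 (U L *+ p.+2 + U (h n) + U (h n))%MM = 0.
Proof.
have n1 : (1 <= n)%N by lia.
have n'n : (n.-1 <= n)%N by lia.
have n''n : (n.-2 <= n)%N by lia.
(* In the relation for [(h^(n-2), h, h^n, h^n)], every product except [h^(n-2) * h] is a power of
   [h] beyond [h^n]. *)
have vanish : E b.+1 (U L *+ p + U (h n) + U (h n) + U (h n.-1))%MM = 0.
  have := diff_wdvvS (h n.-2) (h 1) (h n) (h n) (U L *+ p)%MM.
  rewrite !split_sum_eq0; first last.
  - move=> k k' m rE; left; apply: diffGW_ltL.
    by have := congr1 (fun x : mnm => x L) rE; count_L.
  - move=> k k' m rE; right; apply: diffGW_ltL.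
    by have := congr1 (fun x : mnm => x L) rE; count_L.
  - move=> k k' m rE; left; apply: diffGW_ltL.
    by have := congr1 (fun x : mnm => x L) rE; count_L.
  - move=> k k' m rE; right; apply: diffGW_ltL.
    by have := congr1 (fun x : mnm => x L) rE; count_L.
  rewrite !addr0 !mulr0 !addr0.
  rewrite (@cup_insertE _ _ _ n_gt2 _ _ _ _ 1 (h n.-1)); last first.
    by rewrite Delta_mulH // (_ : (n.-2 + 1)%N = n.-1) ?n'n ?scale1r //; lia.
  rewrite mul1r !(cup_insert_eq0 n_gt2) ?addr0 //.
  + by rewrite Delta_mulH // ifN //; lia.
  + by rewrite Delta_mulH // ifN //; lia.
  + by rewrite Delta_mulH // ifN //; lia.
(* Here [h^(n-1) * h] produces the required term, and [Delta_L^2] a multiple of the one in [vanish],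
   up to the divisor [h]. *)
have := diff_wdvvS (h n.-1) (h 1) L L (U (h n) + U L *+ p)%MM.
rewrite !split_sum_eq0; first last.
- move=> k k' m rE; left; apply: (diffGW_hk (k := n.-1)); first by lia.
  by rewrite !mnmDE !mnm1E eqxx; lia.
- move=> k k' m rE; right; apply: diffGW_ltL.
  by have := congr1 (fun x : mnm => x L) rE; count_L.
- move=> k k' m rE; left; apply: diffGW_ltL.
  by have := congr1 (fun x : mnm => x L) rE; count_L.
- move=> k k' m rE; right; apply: (diffGW_hk (k := n.-1)); first by lia.
  by rewrite !mnmDE !mnm1E eqxx; lia.
rewrite !addr0 !mulr0 !addr0.
rewrite (@cup_insertE _ _ _ n_gt2 _ _ _ _ 1 (h n)); last first.
  by rewrite Delta_mulH // (_ : (n.-1 + 1)%N = n) ?leqnn ?scale1r //; lia.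
rewrite mul1r (cup_insertE n_gt2 _ _ (Delta_mulLL Q n_gt2)).
rewrite !(cup_insert_eq0 n_gt2) ?Delta_mulHL ?addr0 //; try lia.
rewrite (_ : (U (h n) + U L *+ p + U (h n.-1) + U (h 1) + U (h n)
   = U L *+ p + U (h n) + U (h n) + U (h n.-1) + U (h 1))%MM); last by mnm_ac.
rewrite diffGW_divisor // vanish !mulr0 addr0 => <-.
by congr (E _ _); mnm_ac.
Qed.

Lemma diffGW_pureL_degree : E b (U L *+ p.+4)%MM = 0.
Proof.
have n1 : (1 <= n)%N by lia.
have := diff_wdvvS L L (h 1) (h n) (U L *+ p.+2)%MM.
rewrite !mulrDr split_sum_pureL split_sum_pureL_swap.
rewrite !(split_sum_eq0 (F := G' 1)); first last.
- move=> k k' m rE; right; apply: (diffGW_hk (k := n)); first by lia.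
  by rewrite !mnmDE !mnm1E eqxx; lia.
- move=> k k' m rE; right; apply: (diffGW_hk (k := n)); first by lia.
  by rewrite !mnmDE !mnm1E eqxx; lia.
rewrite !mulr0 !addr0 (cup_insertE n_gt2 _ _ (Delta_mulLL Q n_gt2)).
rewrite !(cup_insert_eq0 n_gt2) ?Delta_mulLH //; try lia; last first.
  by rewrite Delta_mulH // ifN //; lia.
rewrite (_ : (_ + U (h 1) + U (h n) + U (h n)
   = U L *+ p.+2 + U (h n) + U (h n) + U (h 1))%MM); last by mnm_ac.
rewrite diffGW_divisor // diffGW_nextL !mulr0 !addr0 !add0r => /eqP.
(* With [e] the value sought, the relation now reads [(2 b - 2 (p + 2)) e = - 2 b e]. *)
rewrite eq_sym -subr_eq0 -mulNr -mulrBl mulf_eq0 => /orP[|/eqP//].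
rewrite (_ : _ - _ = 2 * (p.+2%:R - (2 * b)%:R)); last by rewrite natrM; ring.
rewrite mulf_eq0 pnatr_eq0 /= subr_eq0 eqr_nat => /eqP pb.
(* If [p + 2 = 2 b], the degree equation becomes [4 b + 4 = 6]. *)
by have := deg_p; rewrite (_ : p.+4 = (2 * b).+2); nia.
Qed.

End PureL.

Lemma diffGW_pureL (l : nat) : E b (U L *+ l)%MM = 0.
Proof.
apply/eqP; apply/idPn => El; have := diffGW_L_degree El.
rewrite mulmnE mnm1E eqxx mul1n => dl.
(* The degree equation gives [(n - 2) l = 2 n (b + 1) - 6 > 4 (n - 2)]. *)
have [p lE] : exists p, l = p.+4 by exists (l - 4)%N; nia.
by move: El dl; rewrite lE => El /diffGW_pureL_degree E0; rewrite E0 eqxx in El.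
Qed.

Lemma diffGW_level (r : mnm) : E b r = 0.
Proof.
have [l] := ubnP (mdeg r); elim: l r => // l IHl r rl.
have [/existsP[i /and3P[i1 iL ri]]|] :=
  boolP [exists i, [&& i != h 1, i != L & (0 < r i)%N]].
  exact: diffGW_higher ri.
rewrite negb_exists => /forallP r0.
have [r1|r1] := posnP (r (h 1)).
  suff -> : r = (U L *+ r L)%MM by apply: diffGW_pureL.
  apply/mnmP => i; rewrite mulmnE mnm1E.
  have [<-|iL] := eqVneq L i; first by rewrite mul1n.
  have [->//|i1] := eqVneq i (h 1).
  by have := r0 i; rewrite i1 eq_sym iL /=; lia.
have [s rE] := mnm_splitU r1.
rewrite rE diffGW_divisor // IHl ?mulr0 //.
by move: rl; rewrite rE mdegD mdeg1; lia.
Qed.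

End Level.

Lemma coefGW_unique (b : nat) (r : mnm) : G b r = G' b r.
Proof.
apply/eqP; rewrite -subr_eq0 -/(E b r); apply/eqP.
elim/ltn_ind: b r => -[|b] IHb r; first exact: diffGW0.
by apply: diffGW_level.
Qed.

End Difference.

(** * From basis elements to arbitrary classes *)

Section MultilinearFamilies.
Variables (R : realType) (V : lmodType R) (I : finType) (B : I -> V).

Lemma multilinear_sum (f : seq V -> R) (c : I -> R) (s t : seq V) :
  multilinear_family f ->
  f (s ++ (\sum_i c i *: B i) :: t) = \sum_i c i * f (s ++ B i :: t).
Proof.
move=> fl; elim: (index_enum I) => [|i r IHr]; last by rewrite !big_cons fl IHr.
rewrite !big_nil; have := fl s t 1 0 0; rewrite scale1r addr0 mul1r => f0.
by apply: (addrI (f (s ++ 0 :: t))); rewrite -f0 addr0.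
Qed.

Lemma multilinear_ext (f g : seq V -> R) :
  multilinear_family f -> multilinear_family g ->
  (forall v, exists c : I -> R, v = \sum_i c i *: B i) ->
  (forall s : seq I, f (map B s) = g (map B s)) -> forall A, f A = g A.
Proof.
move=> fl gl Bgen fg A.
(* Insertions are expanded from left to right; the prefix [map B s] holds those already replaced by
   basis elements. *)
suff fgA (s : seq I) : f (map B s ++ A) = g (map B s ++ A) by apply: (fgA [::]).
elim: A s => [|v A IHA] s; first by rewrite cats0.
have [c ->] := Bgen v; rewrite !multilinear_sum //; apply: eq_bigr => i _.
by have := IHA (rcons s i); rewrite map_rcons !cat_rcons => ->.
Qed.

End MultilinearFamilies.

(** * Uniqueness of the closed and open invariants *)

Lemma closed_GW_unique (R : realType) (n : nat) (Q : quadric R n)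
    (GW GW' : closed_family Q) : (2 < n)%N ->
  closed_GW_theory GW -> closed_GW_theory GW' ->
  forall beta A, GW beta A = GW' beta A.
Proof.
move=> n2 GWt GWt' [b|b] A; last first.
  by rewrite (closed_negative GWt) ?(closed_negative GWt').
apply: (multilinear_ext (B := Delta Q)) => [||v|s].
- exact: closed_multilinear.
- exact: closed_multilinear.
- by have [c [vE _]] := delta_basis v; exists c.
pose r := [multinom count_mem i s | i < n.+2].
have rs : perm_eq (index_seq r) s by apply: perm_index_seq => i; rewrite mnmE.
by rewrite (GW_perm GWt b rs) (GW_perm GWt' b rs); apply: coefGW_unique.
Qed.

Lemma open_GW_unique (R : realType) (n : nat) (Q : quadric R n)
    (GW : closed_family Q) (OGW OGW' : open_family Q) :
  open_GW_theory GW OGW -> open_GW_theory GW OGW' ->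
  forall beta k A, OGW beta k A = OGW' beta k A.
Proof.
move=> Ot Ot' beta [|[|k]] A.
- by rewrite (open_no_boundary Ot) (open_no_boundary Ot').
- have c0 : (-1) ^+ n./2 * 2 != 0 :> R.
    by rewrite mulf_neq0 ?signr_eq0 ?pnatr_eq0.
  (* Integration over L is pairing with [Delta_L], so dividing by the self-intersection of [Delta_L]
     normalizes the integral to 1. *)
  pose eta := ((-1) ^+ n./2 * 2)^-1 *: dualL Q.
  have eta_deg : of_deg n eta.
    have [c cE] := of_deg_L Q.
    exists (fun i => ((-1) ^+ n./2 * 2)^-1 * c i).
    rewrite /eta -[X in _ *: X]Delta_L [X in _ *: X]cE scaler_sumr.
    by apply: eq_bigr => i _; rewrite scalerA.
  have eta_L : intL Q eta = 1.
    by rewrite linearZ /= intL_dual intX_dualL /GRing.scale /= mulVf.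
  rewrite (open_closed (open_GW_closed Ot) beta A eta_deg eta_L).
  by rewrite (open_closed (open_GW_closed Ot') beta A eta_deg eta_L).
- rewrite (open_closed_vanishing (open_GW_closed Ot)); last by left.
  by rewrite (open_closed_vanishing (open_GW_closed Ot')); last by left.
Qed.

Theorem theorem8 (R : realType) (n : nat) (n_gt2 : (2 < n)%N)
    (n_even : ~~ odd n) (Q : quadric R n)
    (GW : closed_family Q) (GW_known : closed_GW_theory GW)
    (OGW : open_family Q) (OGW_known : open_GW_theory GW OGW) :
  (forall OGW' : open_family Q, open_GW_theory GW OGW' ->
     forall (beta : int) (k : nat) (A : seq (rel_coh Q)),
       OGW' beta k A = OGW beta k A) /\
  (forall GW' : closed_family Q, closed_GW_theory GW' ->
     forall (beta : int) (A : seq (coh Q)), GW' beta A = GW beta A).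
Proof.
split=> [OGW' OGW't | GW' GW't] beta.
  exact: (open_GW_unique OGW't OGW_known).
exact: closed_GW_unique.
Qed.
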